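(* Let $(x_i,y_i)_{i=1}^n$ be training data with $x_i\in\mathbb{R}^d$, $\|x_i\|\le1$, $y_i\in\{-1,1\}$, let $\lambda\ge 0$, let $f_\theta$ be a $K$-layer neural network with $H$-positively homogeneous activation function $\sigma$, such that $f_\theta$ is locally Lipschitz (in $\theta$), and let $L(\theta)=\frac1n\sum_{i=1}^n\ell(y_if_\theta(x_i))$ with logistic loss $\ell(z)=\ln(1+e^{-z})$. Let $\theta$ satisfy the alignment condition $\lambda\theta=-\nabla L(\theta)$ (in the non-smooth case: $\lambda\theta=-g$ for some $g\in\partial L(\theta)$). Then for every $k\in\{1,\dots,K\}$, $$\lambda\|W_k\|_F^2=-\frac{H^{K-k}}{n}\sum_{i=1}^n \ell'(y_if_\theta(x_i))\,y_i\,f_\theta(x_i).$$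
   Context: Network: $f_\theta(x)=\langle w_K,h_{K-1}\rangle$, $h_k=\sigma(W_kh_{k-1})$ for $k\in\{1,\dots,K-1\}$, $h_0=x$, where $W_1\in\mathbb{R}^{m\times d}$, $W_k\in\mathbb{R}^{m\times m}$ for $2\le k\le K-1$, $w_K\in\mathbb{R}^m$, and $W_K:=w_K^\top$; $\theta=(\mathrm{vec}(W_1),\dots,\mathrm{vec}(W_K))$; $\sigma:\mathbb{R}^m\to\mathbb{R}^m$. The activation is $H$-positively homogeneous if $\sigma(\alpha v)=\alpha^H\sigma(v)$ for all $\alpha\ge0$ and all $v$. $\|\cdot\|_F$ is the Frobenius norm. For a locally Lipschitz $F:\mathbb{R}^p\to\mathbb{R}$, $\partial F(\theta)=\mathrm{conv}\{g:\exists\,\theta_j\to\theta,\ \nabla F(\theta_j)\to g\}$ is the Clarke differential. Standing assumption of the paper: the chain rule holds, i.e. $\frac{d}{dt}F(\theta(t))=\langle g,\dot\theta(t)\rangle$ for all $g\in\partial F(\theta(t))$. *)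

(* Defs.v *)
From HB Require Import structures.
From mathcomp Require Import all_boot all_order all_algebra.
From mathcomp Require Import all_classical all_reals all_analysis.

Set Implicit Arguments.
Unset Strict Implicit.
Unset Printing Implicit Defensive.

Import Order.TTheory GRing.Theory Num.Theory.
Import numFieldNormedType.Exports.

Local Open Scope classical_set_scope.
Local Open Scope ring_scope.

(* On column vectors [normF] is the Euclidean norm.  The library norm [`|A|] of
   a matrix is the sup norm; it is used below only for topological notions,
   where the choice of the norm on R^p is irrelevant. *)
Definition normF {R : realType} {a b : nat} (A : 'M[R]_(a, b)) : R :=
  Num.sqrt (\sum_i \sum_j A i j ^+ 2).

Definition dotv {R : realType} {p : nat} (u v : 'rV[R]_p) : R :=
  \sum_j u 0 j * v 0 j.

Definition locally_lipschitz {R : realType} {V W : normedModType R}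
    (F : V -> W) : Prop :=
  forall x : V, exists2 U : set V, nbhs x U & [lipschitz F z | z in U].

(* The partial derivatives are total functions: [grad F x] is the gradient of F
   at x only together with [differentiable F x]. *)
Definition grad {R : realType} {p : nat} (F : 'rV[R]_p -> R) (x : 'rV[R]_p) :
  'rV[R]_p := \row_j 'D_(delta_mx 0 j) F x.

Definition conv_hull {R : realType} {V : lmodType R} (A : set V) : set V :=
  [set g | exists (N : nat) (c : 'I_N -> R) (v : 'I_N -> V),
    [/\ forall i, 0 <= c i, \sum_i c i = 1, forall i, A (v i)
      & g = \sum_i c i *: v i]].

Definition clarke {R : realType} {p : nat} (F : 'rV[R]_p -> R)
    (x : 'rV[R]_p) : set 'rV[R]_p :=
  conv_hull (V := 'rV[R]_p) [set g : 'rV[R]_p | exists u : nat -> 'rV[R]_p,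
    [/\ forall j, differentiable F (u j), u @ \oo --> x
      & (fun j => grad F (u j)) @ \oo --> g]].

Definition absolutely_continuous_on {R : realType} {V : normedModType R}
    (a b : R) (c : R -> V) : Prop :=
  forall e : R, 0 < e -> exists2 del : R, 0 < del &
    forall (N : nat) (s t : 'I_N -> R),
      (forall i, [/\ a <= s i, s i <= t i & t i <= b]) ->
      (forall i j, i != j -> t i <= s j \/ t j <= s i) ->
      \sum_i (t i - s i) < del ->
      \sum_i `|c (t i) - c (s i)| < e.

(* An arc is a curve on [0, +oo) that is absolutely continuous on every compact
   subinterval; the chain rule is required at almost every time only. *)
Definition chain_rule {R : realType} {p : nat} (F : 'rV[R]_p -> R) : Prop :=
  forall c : R -> 'rV[R]_p,
    (forall T : R, 0 < T -> absolutely_continuous_on 0 T c) ->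
    {ae @lebesgue_measure R, forall t : R, 0 < t ->
      derivable c t 1 /\
      forall g, clarke F (c t) g ->
        is_derive t 1 (F \o c) (dotv g (derive1 c t))}.

(* [powR] satisfies [0 `^ 0 = 1] and agrees with [_ ^+ _] on natural exponents. *)
Definition pos_homogeneous {R : realType} {m : nat} (H : R)
    (sigma : 'cV[R]_m -> 'cV[R]_m) : Prop :=
  forall (a : R) (v : 'cV[R]_m),
    0 <= a -> sigma (a *: v) = (a `^ H) *: sigma v.

(* Dimension of h_k. *)
Definition width (d m k : nat) : nat := if k is _.+1 then m else d.

(* K layers: the weight matrices W_1, ..., W_(K-1) have m rows, and W_K is a
   single row; W_k has [width d m k.-1] columns.  For K >= 2 the last width
   [width d m K.-1] is m. *)
Definition nparams (d m K : nat) : nat :=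
  (\sum_(k < K.-1) m * width d m k + width d m K.-1)%N.

Section Network.
Context {R : realType} {d m K : nat}.
Implicit Type theta : 'rV[R]_(nparams d m K).

(* [hiddenW theta k] is W_(k+1), the index k : 'I_K.-1 being 0-based.  [vec_mx]
   reads blocks row by row; every statement below is invariant under a
   permutation of the coordinates inside a block. *)
Definition hiddenW theta (k : 'I_K.-1) : 'M[R]_(m, width d m k) :=
  vec_mx (submxrow (q_ := fun k : 'I_K.-1 => (m * width d m k)%N)
            (lsubmx theta) k).

Definition outW theta : 'rV[R]_(width d m K.-1) := rsubmx theta.

(* [weight_normF theta k] is |W_k|_F, with the 1-based index 1 <= k <= K. *)
Definition weight_normF theta (k : nat) : R :=
  if insub k.-1 is Some j then normF (hiddenW theta j) else normF (outW theta).

Fixpoint hidden (sigma : 'cV[R]_m -> 'cV[R]_m) theta (x : 'cV[R]_d) (k : nat) :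
    (k <= K.-1)%N -> 'cV[R]_(width d m k) :=
  match k with
  | 0 => fun _ => x
  | k'.+1 => fun lt_k' =>
      sigma (hiddenW theta (Ordinal lt_k') *m
             hidden sigma theta x (ltnW lt_k'))
  end.

Definition network (sigma : 'cV[R]_m -> 'cV[R]_m) theta (x : 'cV[R]_d) : R :=
  (outW theta *m hidden sigma theta x (leqnn K.-1)) 0 0.

End Network.

Definition logistic {R : realType} (z : R) : R := ln (1 + expR (- z)).

Definition empirical_loss {R : realType} {d m K n : nat}
    (sigma : 'cV[R]_m -> 'cV[R]_m) (x : 'I_n -> 'cV[R]_d) (y : 'I_n -> R)
    (theta : 'rV[R]_(nparams d m K)) : R :=
  n%:R^-1 * \sum_(i < n) logistic (y i * network sigma theta (x i)).

Definition aligned {R : realType} {p : nat} (lambda : R) (L : 'rV[R]_p -> R)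
    (theta : 'rV[R]_p) : Prop :=
  (differentiable L theta /\ lambda *: theta = - grad L theta) \/
  (exists2 g, clarke L theta g & lambda *: theta = - g).

(* Main.v *)
Require Import Defs.
From HB Require Import structures.
From mathcomp Require Import all_boot all_order all_algebra.
From mathcomp Require Import all_classical all_reals all_analysis.
Import Order.TTheory GRing.Theory Num.Theory.
Import numFieldNormedType.Exports.
Local Open Scope classical_set_scope.
Local Open Scope ring_scope.

(** Scaling W_k by a > 0 multiplies every network output by a^(H^(K-k)), hence
    a |-> L is smooth along this ray whatever the regularity of L.  At a point of
    differentiability, its derivative at a = 1 computes <grad L, (0,..,W_k,..,0)>
    as H^(K-k)/n times the sum in the statement.  Both sides are continuous in
    (grad L, theta), so the identity passes to limits of gradients and, being
    affine in the gradient, to the whole Clarke differential; pairing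
    lambda theta = -g with (0,..,W_k,..,0) concludes. *)

(** * Continuity, Euclidean pairing and gradients *)

Lemma locally_lipschitz_continuous (R : realType) (V W : normedModType R)
    (F : V -> W) : locally_lipschitz F -> continuous F.
Proof.
move=> + x => /(_ x)[U Ux [M [_ /(_ (Num.max M 0 + 1))]]].
(* The Lipschitz bound holds for every constant above [M]; this one is moreover positive, so the
   radius [e / k] below makes sense. *)
have ltM : M < Num.max M 0 + 1.
  by rewrite (@le_lt_trans _ _ (Num.max M 0)) ?ltrDl // le_max lexx.
move=> /(_ ltM) /= lipF.
set k : R := Num.max M 0 + 1 in lipF ltM.
have k0 : 0 < k by rewrite ltr_wpDl // le_max lexx orbT.
apply/cvgrPdist_lt => e e0; near=> z.
apply: (@le_lt_trans _ _ (k * `|x - z|)).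
  apply: (lipF (x, z)); split => /=; first exact: nbhs_singleton.
  by near: z.
rewrite mulrC -ltr_pdivlMr //; near: z.
by have /cvgrPdist_lt := @cvg_id V (nbhs x); apply; rewrite divr_gt0.
Unshelve. all: by end_near. Qed.

Lemma normF_sqr {R : realType} {a b : nat} (A : 'M[R]_(a, b)) :
  normF A ^+ 2 = \sum_i \sum_j A i j ^+ 2.
Proof.
rewrite /normF sqr_sqrtr //.
by apply: sumr_ge0 => i _; apply: sumr_ge0 => j _; exact: sqr_ge0.
Qed.

(** As a matrix product, the pairing inherits linearity and the block product rules. *)
Lemma dotv_mulmx {R : realType} {p : nat} (u v : 'rV[R]_p) :
  dotv u v = (u *m v^T) 0 0.
Proof. by rewrite mxE; apply: eq_bigr => j _; rewrite mxE. Qed.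

Lemma dotvv_normF {R : realType} {p : nat} (u : 'rV[R]_p) :
  dotv u u = normF u ^+ 2.
Proof. by rewrite normF_sqr big_ord1; apply: eq_bigr => j _; rewrite expr2. Qed.

Lemma normF_vec_mx {R : realType} {a b : nat} (u : 'rV[R]_(a * b)) :
  normF (vec_mx u) = normF u.
Proof.
rewrite /normF big_ord1; congr Num.sqrt.
rewrite (reindex _ (curry_mxvec_bij a b)) /=.
rewrite pair_bigA; apply: eq_bigr => -[i j] _ /=.
by rewrite mxE.
Qed.

Lemma dotvZl {R : realType} {p : nat} (c : R) (u v : 'rV[R]_p) :
  dotv (c *: u) v = c * dotv u v.
Proof. by rewrite !dotv_mulmx -scalemxAl mxE. Qed.

Lemma dotvNl {R : realType} {p : nat} (u v : 'rV[R]_p) :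
  dotv (- u) v = - dotv u v.
Proof. by rewrite -scaleN1r dotvZl mulN1r. Qed.

Lemma dotv_suml {R : realType} {p N : nat} (u : 'I_N -> 'rV[R]_p) v :
  dotv (\sum_i u i) v = \sum_i dotv (u i) v.
Proof.
rewrite dotv_mulmx mulmx_suml summxE.
by apply: eq_bigr => i _; rewrite dotv_mulmx.
Qed.

(** Differentiability makes the derivative linear in its direction; expand [v] in the standard
    basis. *)
Lemma derive_grad {R : realType} {p : nat} (F : 'rV[R]_p -> R)
    (x v : 'rV[R]_p) :
  differentiable F x -> 'D_v F x = dotv (grad F x) v.
Proof.
move=> dF; rewrite deriveE // {1}(row_sum_delta v) linear_sum.
apply: eq_bigr => j _; rewrite linearZ mxE deriveE //.
exact: mulrC.
Qed.

(** * Extracting and rescaling a single layer *)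

Section Layer.
Context {R : realType} {d m K : nat}.
Implicit Type theta : 'rV[R]_(nparams d m K).

(* (0,..,W_k,..,0), with the 1-based index k. *)
Definition layer (k : nat) theta : 'rV[R]_(nparams d m K) :=
  row_mx (\mxrow_(i < K.-1) (if i.+1 == k then submxrow (lsubmx theta) i else 0))
         (if k == K then rsubmx theta else 0).

(** This multiplies W_k by [a]. The affine form makes the derivative at [a = 1] a directional
    derivative along [layer k theta]. *)
Definition scale_layer (k : nat) (a : R) theta := theta + (a - 1) *: layer k theta.

(** [layer k] is multiplication by a fixed 0/1 mask, its value at the all-ones vector; limits can
    thus be taken coordinate by coordinate. *)
Lemma layerE k theta j :
  layer k theta 0 j = layer k (const_mx 1) 0 j * theta 0 j.
Proof.
rewrite /layer !mxE; case: splitP => [l|l] jl.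
  rewrite !mxE; case: eqP => _; rewrite !mxE ?mul0r // tagnat.sig2K mul1r.
  by congr (theta 0 _); apply: val_inj.
case: eqP => _; rewrite !mxE ?mul0r // mul1r.
by congr (theta 0 _); apply: val_inj.
Qed.

Lemma cvg_dotv_layer k (g u : nat -> 'rV[R]_(nparams d m K)) a theta :
  g @ \oo --> a -> u @ \oo --> theta ->
  dotv (g j) (layer k (u j)) @[j --> \oo] --> dotv a (layer k theta).
Proof.
move=> ga utheta; apply: cvg_big => [|i _]; first exact: add_continuous.
have coord (v : nat -> 'rV[R]_(nparams d m K)) (b : 'rV[R]_(nparams d m K)) :
    v @ \oo --> b -> v j 0 i @[j --> \oo] --> b 0 i.
  by move=> vb; apply: (cvg_comp v (fun M : 'rV_(nparams d m K) => M 0 i) vb);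
     exact: coord_continuous.
apply: cvgM; first exact: coord.
under eq_cvg do rewrite layerE.
by rewrite layerE; apply: cvgM; [exact: cvg_cst|exact: coord].
Qed.

Lemma dotv_layer k theta : (0 < k <= K)%N ->
  dotv theta (layer k theta) = weight_normF theta k ^+ 2.
Proof.
case: k => // k /= kK.
rewrite dotv_mulmx -{1}(hsubmxK theta) /layer tr_row_mx mul_row_col.
rewrite -{1}(submxrowK (lsubmx theta)) tr_mxrow mul_mxrow_mxcol mxE summxE.
(* The layer index is now [k.+1]. [insub] succeeds when [k < K.-1], a hidden layer; otherwise
   [k.+1 = K] and only the output block survives. *)
rewrite /weight_normF /=; case: insubP => [i ltk ik|].
  subst k; rewrite (bigD1 i) //= eqxx -dotv_mulmx dotvv_normF /hiddenW normF_vec_mx.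
  rewrite [X in _ + X + _]big1 => [|i' i'i].
    rewrite ifF; first by rewrite trmx0 mulmx0 mxE !addr0.
    by apply/negbTE; rewrite neq_ltn -ltn_predRL ltk.
  by rewrite eqSS (negbTE i'i : val i' == val i = _) trmx0 mulmx0 mxE.
rewrite -leqNgt => leK.
have kE : k.+1 == K.
  by rewrite eqn_leq kK /=; case: (K) leK kK.
rewrite kE -dotv_mulmx dotvv_normF [X in X + _]big1 ?add0r // => i _.
rewrite ifF ?trmx0 ?mulmx0 ?mxE //.
by apply/negbTE; rewrite eqSS neq_ltn (leq_trans (ltn_ord i) leK).
Qed.

Lemma hiddenW_scale_layer k a theta (i : 'I_K.-1) :
  hiddenW (scale_layer k a theta) i =
  (if i.+1 == k then a else 1) *: hiddenW theta i.
Proof.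
rewrite /hiddenW /scale_layer /layer -linearZ; congr vec_mx.
rewrite linearD linearZ /= row_mxKl submxrowD.
have -> B : submxrow ((a - 1) *: B) i = (a - 1) *: submxrow B i.
  by apply/matrixP => j l; rewrite !mxE.
rewrite mxrowK; case: eqP => _; rewrite ?scaler0 ?addr0 ?scale1r //.
by rewrite -{1}[submxrow _ _]scale1r -scalerDl addrC subrK.
Qed.

Lemma outW_scale_layer k a theta :
  outW (scale_layer k a theta) = (if k == K then a else 1) *: outW theta.
Proof.
rewrite /outW /scale_layer /layer linearD linearZ /= row_mxKr.
by case: eqP => _; rewrite ?scaler0 ?addr0 ?scale1r // -{1}[rsubmx _]scale1r
  -scalerDl addrC subrK.
Qed.

Lemma scale_layer1 k theta : scale_layer k 1 theta = theta.
Proof. by rewrite /scale_layer subrr scale0r addr0. Qed.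

Section Homogeneous.
Context {H : R} {sigma : 'cV[R]_m -> 'cV[R]_m}.
Hypothesis hsigma : pos_homogeneous H sigma.

(** Layers before [k] are unchanged. Layer [k] contributes a factor [a], and each activation from
    layer [k] to layer [l] raises the accumulated factor to the power [H]: there are [(l - k).+1] of
    them. *)
Lemma hidden_scale_layer k a theta (x : 'cV[R]_d) l (lK : (l <= K.-1)%N) :
  (0 < k)%N -> 0 < a ->
  hidden sigma (scale_layer k a theta) x lK =
  (a `^ (if (k <= l)%N then H ^+ (l - k).+1 else 0)) *: hidden sigma theta x lK.
Proof.
move=> k0 a0; elim: l lK => [|l IH] lK /=.
  by rewrite leqNgt k0 powRr0 scale1r.
rewrite IH hiddenW_scale_layer /= -scalemxAl -scalemxAr scalerA.
rewrite hsigma ?mulr_ge0 ?powR_ge0 //; last by case: ifP; rewrite ltW.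
congr (_ *: _); case: (ltngtP k l.+1) => [kl|lk|->].
- by rewrite ltnS in kl; rewrite kl mul1r -powRrM -exprSr subSn.
- by rewrite leqNgt (ltn_trans _ lk) // powRr0 mul1r powR1.
by rewrite ltnn powRr0 mulr1 subnn expr1.
Qed.

(** The output layer has no activation, so [K - k] activations act on the factor [a]; for [k = K] it
    enters linearly. *)
Lemma network_scale_layer k a theta (x : 'cV[R]_d) :
  (0 < k <= K)%N -> 0 < a ->
  network sigma (scale_layer k a theta) x =
  a `^ (H ^+ (K - k)) * network sigma theta x.
Proof.
move=> /andP[k0 kK] a0.
rewrite /network hidden_scale_layer // outW_scale_layer.
rewrite -scalemxAl -scalemxAr scalerA mxE; congr (_ * _).
have K0 : (0 < K)%N by exact: leq_trans kK.
move: kK; rewrite leq_eqVlt => /orP[/eqP kE|kK].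
  by rewrite kE eqxx leqNgt prednK // leqnn subnn powRr0 mulr1 expr0 powRr1 // ltW.
have kK1 : (k <= K.-1)%N by rewrite -ltnS prednK.
by rewrite ltn_eqF // mul1r kK1 -subSn // prednK.
Qed.

End Homogeneous.
End Layer.

(** * The logistic loss and its derivative *)

Lemma is_derive_logistic {R : realType} (z : R) :
  is_derive z 1 logistic (- expR (- z) / (1 + expR (- z))).
Proof.
have d1 : is_derive (1 + expR (- z)) 1 (@ln R) (1 + expR (- z))^-1.
  by apply: is_derive1_ln; rewrite addr_gt0 ?expR_gt0.
have d2 : is_derive z 1 (fun z : R => 1 + expR (- z)) (0 + expR (- z) * -1).
  have dexp : is_derive z 1 (expR \o -%R) (expR (- z) * -1).
    by apply: is_derive1_comp; exact: is_deriveN.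
  exact: is_deriveD (is_derive_cst (1 : R) z 1) dexp.
have dl : is_derive z 1 logistic _ :=
  is_derive1_comp (g := fun z : R => 1 + expR (- z)) d1 d2.
apply: is_derive_eq dl _.
by rewrite add0r mulrN1 mulrC.
Qed.

Lemma derive1_logistic {R : realType} (z : R) :
  derive1 logistic z = - expR (- z) / (1 + expR (- z)).
Proof. by rewrite derive1E (@derive_val _ _ _ _ _ _ _ (is_derive_logistic z)). Qed.

(** Used to pass to the limit along the sequences defining the Clarke differential. *)
Lemma continuous_derive1_logistic {R : realType} :
  continuous (derive1 (@logistic R)).
Proof.
rewrite (funext derive1_logistic) => z.
have expN : (fun z : R => expR (- z)) @ z --> expR (- z).
  by apply: (cvg_comp -%R expR); [exact: opp_continuous|exact: continuous_expR].
apply: cvgM; first exact: cvgN.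
apply: cvgV; first by rewrite gt_eqF // addr_gt0 ?expR_gt0.
by apply: cvgD => //; exact: cvg_cst.
Qed.

(** * Pairing the gradients of the empirical loss with a layer *)

Section Loss.
Context {R : realType} {d m K n : nat}.
Context {H : R} {sigma : 'cV[R]_m -> 'cV[R]_m}.
Hypothesis hsigma : pos_homogeneous H sigma.
Variables (x : 'I_n -> 'cV[R]_d) (y : 'I_n -> R).
Implicit Type theta : 'rV[R]_(nparams d m K).

(** The right-hand side of the theorem without the factor [- H ^+ (K - k)], hence independent of the
    layer. *)
Definition margin_term theta : R :=
  n%:R^-1 * \sum_(i < n) derive1 logistic (y i * network sigma theta (x i)) *
    y i * network sigma theta (x i).

Lemma derive_loss_layer k theta : (0 < k <= K)%N ->
  'D_(layer k theta) (empirical_loss sigma x y) theta =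
  H ^+ (K - k) * margin_term theta.
Proof.
move=> hk; set q := H ^+ (K - k); set L := empirical_loss sigma x y.
pose f i := network sigma theta (x i).
(* Both derivatives have the same difference quotient, because [scale_layer k (h + 1) theta] is
   [theta + h *: layer k theta]. *)
have -> : 'D_(layer k theta) L theta =
    'D_1 (fun a : R => L (scale_layer k a theta)) 1.
  pose Q (h : R) := h^-1 *: (L (h *: layer k theta + theta) - L theta).
  rewrite /derive -/Q; suff -> : (fun h : R => h^-1 *: (((fun a : R =>
      L (scale_layer k a theta)) \o shift 1) (h *: 1) -
        L (scale_layer k 1 theta))) = Q by [].
  apply/funext => h; rewrite /Q /=.
  by rewrite scale_layer1 /scale_layer addrK [h *: 1]mulr1 [theta + _]addrC.
pose G : R -> R := n%:R^-1 *:
  \sum_(i < n) (logistic \o (fun a : R => (y i * f i) * a `^ q)).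
(* [G] is the loss on the ray, with the outputs [f i] at [theta] frozen. The scaling law is applied
   for [a > 0], so the two functions are compared only near 1, which determines the derivative. *)
have -> : 'D_1 (fun a : R => L (scale_layer k a theta)) 1 = 'D_1 G 1.
  apply: (@near_eq_derive R R^o R^o _ G 1 1); near=> a.
  have a0 : 0 < a by near: a; exact: (@lt_nbhsr R 0 1 ltr01).
  rewrite /G /L /empirical_loss /= fct_sumE; congr (_ * _).
  apply: eq_bigr => i _ /=.
  by rewrite (network_scale_layer hsigma) // mulrCA mulrC.
have dG : is_derive (1 : R) 1 G (n%:R^-1 *:
    \sum_(i < n) (derive1 logistic (y i * f i) * ((y i * f i) *: q))).
  apply: is_deriveZ; apply: is_derive_sum => i.
  apply: is_derive1_comp.
    by rewrite powR1 mulr1; rewrite derive1_logistic; exact: is_derive_logistic.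
  apply: is_deriveZ.
  (* At [a = 1] the power with exponent [q] has derivative [q]: here the exponent H^(K-k) becomes a
     factor. *)
  apply: is_derive_eq (is_derive1_powR q ltr01) _.
  by rewrite powR1 mulr1.
rewrite (@derive_val _ _ _ _ _ _ _ dG) /margin_term mulrCA; congr (_ * _).
rewrite mulr_sumr; apply: eq_bigr => i _.
by rewrite /GRing.scale /= [RHS]mulrC !mulrA.
Unshelve. all: by end_near. Qed.

Hypothesis cont_network : forall z : 'cV[R]_d,
  continuous (fun theta : 'rV[R]_(nparams d m K) => network sigma theta z).

Lemma cvg_margin_term (u : nat -> 'rV[R]_(nparams d m K)) theta :
  u @ \oo --> theta -> margin_term (u j) @[j --> \oo] --> margin_term theta.
Proof.
move=> utheta.
have cvgN i : network sigma (u j) (x i) @[j --> \oo] --> network sigma theta (x i).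
  exact: (cvg_comp _ _ utheta (@cont_network (x i) theta)).
apply: cvgM; first exact: cvg_cst.
apply: cvg_big => [|i _]; first exact: add_continuous.
have cvgyN : y i * network sigma (u j) (x i) @[j --> \oo] -->
    y i * network sigma theta (x i).
  by apply: cvgM; [exact: cvg_cst|exact: cvgN].
apply: cvgM; last exact: cvgN.
apply: cvgM; last exact: cvg_cst.
exact: (cvg_comp _ _ cvgyN (@continuous_derive1_logistic R _)).
Qed.

Lemma dotv_clarke_layer k theta g : (0 < k <= K)%N ->
  clarke (empirical_loss sigma x y) theta g ->
  dotv g (layer k theta) = H ^+ (K - k) * margin_term theta.
Proof.
move=> hk [N [c [v [c0 c1 vlim ->]]]].
(* The weights sum to 1, so the right-hand side is a convex combination of copies of itself, and
   each limit [v i] can be treated alone. *)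
rewrite dotv_suml -[RHS]mul1r -c1 mulr_suml; apply: eq_bigr => i _.
rewrite dotvZl; congr (_ * _).
have [u [du utheta gradu]] := vlim i.
have lim1 := cvg_dotv_layer k _ _ _ _ gradu utheta.
have lim2 : H ^+ (K - k) * margin_term (u j) @[j --> \oo] -->
    H ^+ (K - k) * margin_term theta.
  by apply: cvgM; [exact: cvg_cst|exact: cvg_margin_term].
(* The loss is differentiable at every [u j], so the two sequences coincide and their limits
   agree. *)
apply: (cvg_unique _ lim1); first exact: Rhausdorff.
apply: cvg_trans lim2; apply: near_eq_cvg; near=> j.
by rewrite -derive_grad // derive_loss_layer.
Unshelve. all: by end_near. Qed.

End Loss.

Theorem lemma2 (R : realType) (d m K n : nat) (hK : (2 <= K)%N) (hn : (0 < n)%N)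
    (x : 'I_n -> 'cV[R]_d) (y : 'I_n -> R)
    (hx : forall i, normF (x i) <= 1) (hy : forall i, y i = -1 \/ y i = 1)
    (lambda : R) (hlambda : 0 <= lambda)
    (H : R) (sigma : 'cV[R]_m -> 'cV[R]_m) (hsigma : pos_homogeneous H sigma)
    (hlip : forall z : 'cV[R]_d,
      locally_lipschitz
        (fun theta : 'rV[R]_(nparams d m K) => network sigma theta z))
    (hchain : chain_rule
      (fun theta : 'rV[R]_(nparams d m K) => empirical_loss sigma x y theta))
    (theta : 'rV[R]_(nparams d m K))
    (htheta : aligned lambda
      (fun theta' : 'rV[R]_(nparams d m K) => empirical_loss sigma x y theta')
      theta) :
  forall k : nat, (1 <= k <= K)%N ->
    lambda * weight_normF theta k ^+ 2 =
    - (H ^+ (K - k) / n%:R) *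
      \sum_(i < n) derive1 logistic (y i * network sigma theta (x i)) * y i *
                   network sigma theta (x i).
Proof.
move=> k hk.
have cont z := locally_lipschitz_continuous _ _ _ _ (hlip z).
(* Both forms of alignment provide such a [g]: the gradient itself, or a Clarke element. *)
have [g ltheta gE] : exists2 g, lambda *: theta = - g &
    dotv g (layer k theta) = H ^+ (K - k) * margin_term (sigma := sigma) x y theta.
  case: htheta => [[dL ltheta]|[g clg ltheta]].
    exists (grad (empirical_loss sigma x y) theta) => //.
    by rewrite -derive_grad // (derive_loss_layer hsigma).
  by exists g => //; apply: dotv_clarke_layer clg.
rewrite -dotv_layer // -dotvZl ltheta dotvNl gE.
by rewrite /margin_term mulrA mulNr.
Qed.
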